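(* Let $L/K$ be an extension of simple $\mathbb{Q}$-algebras. The following are equivalent: (i) $L/K$ is outer; (ii) $\mathrm{Cent}_L(K)=Z(L)$; (iii) $Z(K)$ is contained in $Z(L)$, and $L$ is generated by $K$ and $Z(L)$; (iv) $Z(K)$ is contained in $Z(L)$, and $L$ is isomorphic to the tensor product $Z(L)\otimes_{Z(K)}K$ as an extension of $K$; (v) $Z(K)$ is contained in $Z(L)$, and the restriction map $\mathrm{Aut}(L/K)\to\mathrm{Aut}(Z(L)/Z(K))$ is bijective.
   Context: All algebras are associative and unital. A simple $\mathbb{Q}$-algebra is assumed finite-dimensional over $\mathbb{Q}$; $Z(A)$ denotes the center of $A$. An extension of a simple $\mathbb{Q}$-algebra $K$ is a simple $\mathbb{Q}$-algebra $L$ with an injective $\mathbb{Q}$-algebra homomorphism $K\hookrightarrow L$ (and $K$ is viewed as a subalgebra of $L$). Two extensions $e_1:K\hookrightarrow L_1$, $e_2:K\hookrightarrow L_2$ are isomorphic if there is a $\mathbb{Q}$-algebra isomorphism $i:L_1\to L_2$ with $e_2=i\circ e_1$. $\mathrm{Aut}(L/K)$ is the group of $\mathbb{Q}$-algebra automorphisms of $L$ acting trivially on $K$. $\mathrm{Cent}_L(K)$ is the subalgebra of elements of $L$ commuting with all elements of $K$. The extension $L/K$ is outer if $\mathrm{Aut}(L/K)$ contains no nontrivial inner automorphism, i.e. no nontrivial automorphism given by conjugation by an element of $L^\times$. In (iv), $Z(L)\otimes_{Z(K)}K$ is an extension of $K$ via $y\mapsto 1\otimes y$. *)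

(* Defs.v *)
From HB Require Import structures.
From mathcomp Require Import all_boot all_order all_algebra all_field.
From mathcomp Require Import boolp.

Set Implicit Arguments.
Unset Strict Implicit.
Unset Printing Implicit Defensive.

Import GRing.Theory.
Local Open Scope ring_scope.
Local Open Scope quotient_scope.

(* Tensor product A (x)_C B of two algebras A, B over a ring C mapping to both
   with central image: formal finite sums of pure tensors, modulo the
   congruence generated by biadditivity and C-balancedness. *)
Section Tensor.
Variables (F : fieldType) (C A B : algType F).
Variables (i : {lrmorphism C -> A}) (j : {lrmorphism C -> B}).

Inductive tens_rel : seq (A * B) -> seq (A * B) -> Prop :=
| tens_refl s : tens_rel s s
| tens_sym s t : tens_rel s t -> tens_rel t s
| tens_trans s t u : tens_rel s t -> tens_rel t u -> tens_rel s u
| tens_perm s t : perm_eq s t -> tens_rel s t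
| tens_cat s t u : tens_rel s t -> tens_rel (s ++ u) (t ++ u)
| tens_0l b : tens_rel [:: (0, b)] [::]
| tens_0r a : tens_rel [:: (a, 0)] [::]
| tens_Dl a a' b : tens_rel [:: (a + a', b)] [:: (a, b); (a', b)]
| tens_Dr a b b' : tens_rel [:: (a, b + b')] [:: (a, b); (a, b')]
| tens_bal a c b : tens_rel [:: (a * i c, b)] [:: (a, j c * b)].

Lemma tens_catl s t u : tens_rel s t -> tens_rel (u ++ s) (u ++ t).
Proof.
move=> st; apply: (tens_trans (t := s ++ u)); first by apply/tens_perm/permEl/perm_catC.
by apply: (tens_trans (tens_cat u st)); apply/tens_perm/permEl/perm_catC.
Qed.

Lemma tens_cat2 s t s' t' :
  tens_rel s t -> tens_rel s' t' -> tens_rel (s ++ s') (t ++ t').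
Proof. by move=> st st'; apply: tens_trans (tens_cat s' st) (tens_catl t st'). Qed.

Lemma tens_map (f : A -> A) (g : B -> B) s t :
  f 0 = 0 -> g 0 = 0 -> {morph f : x y / x + y} -> {morph g : x y / x + y} ->
  (forall a c b, tens_rel [:: (f (a * i c), g b)] [:: (f a, g (j c * b))]) ->
  tens_rel s t ->
  tens_rel [seq (f p.1, g p.2) | p <- s] [seq (f p.1, g p.2) | p <- t].
Proof.
move=> f0 g0 fD gD fgC; elim=> {s t} /=.
- by move=> s; apply: tens_refl.
- by move=> s t _; apply: tens_sym.
- by move=> s t u _ st _; apply: tens_trans.
- by move=> s t st; apply: tens_perm; apply: perm_map.
- by move=> s t u _ st; rewrite !map_cat; apply: tens_cat.
- by move=> b; rewrite f0; apply: tens_0l.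
- by move=> a; rewrite g0; apply: tens_0r.
- by move=> a a' b; rewrite fD; apply: tens_Dl.
- by move=> a b b'; rewrite gD; apply: tens_Dr.
- by move=> a c b; apply: fgC.
Qed.

Definition tens_eq (s t : seq (A * B)) : bool := `[< tens_rel s t >].

Lemma tens_eq_equiv : equiv_class_of tens_eq.
Proof.
split=> [s|s t|t s u].
- by apply/asboolP; apply: tens_refl.
- by apply/asboolP/asboolP; apply: tens_sym.
- by move=> /asboolP st /asboolP tu; apply/asboolP; apply: tens_trans st tu.
Qed.

Canonical tens_eq_equiv_rel := EquivRelPack tens_eq_equiv.

(* The centrality proofs are only used by the multiplication below. *)
Definition tensor (ci : forall c a, GRing.comm (i c) a)
    (cj : forall c b, GRing.comm (j c) b) := {eq_quot tens_eq}.

Section Structure.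
Variables (ci : forall c a, GRing.comm (i c) a).
Variables (cj : forall c b, GRing.comm (j c) b).
Local Notation T := (tensor ci cj).

HB.instance Definition _ := Choice.on T.
HB.instance Definition _ := EqQuotient.on T.

Definition tclass (s : seq (A * B)) : T := \pi_T s.
Definition pure (a : A) (b : B) : T := tclass [:: (a, b)].

Lemma tclassE s t : tclass s = tclass t <-> tens_rel s t.
Proof.
by split=> [/eqmodP/asboolP//|st]; apply/eqmodP/asboolP.
Qed.

Lemma tclassP (x : T) : exists s, x = tclass s.
Proof. by exists (repr x); rewrite /tclass reprK. Qed.

Definition sopp (s : seq (A * B)) := [seq (- p.1, p.2) | p <- s].
Definition smul (s t : seq (A * B)) :=
  [seq (p.1 * q.1, p.2 * q.2) | p <- s, q <- t].
Definition sscale (k : F) (s : seq (A * B)) := [seq (k *: p.1, p.2) | p <- s].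

Definition tadd (x y : T) : T := tclass (repr x ++ repr y).
Definition topp (x : T) : T := tclass (sopp (repr x)).
Definition tmul (x y : T) : T := tclass (smul (repr x) (repr y)).
Definition tscale (k : F) (x : T) : T := tclass (sscale k (repr x)).

Lemma repr_rel s : tens_rel (repr (tclass s)) s.
Proof. by apply/tclassE; rewrite /tclass reprK. Qed.

Lemma taddE s t : tadd (tclass s) (tclass t) = tclass (s ++ t).
Proof. by apply/tclassE; apply: tens_cat2; apply: repr_rel. Qed.

Lemma sscale_rel k s t : tens_rel s t -> tens_rel (sscale k s) (sscale k t).
Proof.
apply: (tens_map (f := fun a => k *: a) (g := id)) => //.
- exact: scaler0.
- by move=> x y; rewrite scalerDr.
- by move=> a c b; rewrite scalerAl; apply: tens_bal.
Qed.

Lemma tscaleE k s : tscale k (tclass s) = tclass (sscale k s).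
Proof. by apply/tclassE/sscale_rel/repr_rel. Qed.

Lemma sopp_rel s t : tens_rel s t -> tens_rel (sopp s) (sopp t).
Proof.
apply: (tens_map (f := fun a => - a) (g := id)) => //.
- exact: oppr0.
- by move=> x y; rewrite opprD.
- by move=> a c b; rewrite -mulNr; apply: tens_bal.
Qed.

Lemma toppE s : topp (tclass s) = tclass (sopp s).
Proof. by apply/tclassE/sopp_rel/repr_rel. Qed.

Lemma smul_cons p s t :
  smul (p :: s) t = [seq (p.1 * q.1, p.2 * q.2) | q <- t] ++ smul s t.
Proof. by []. Qed.

Lemma smul_cat s t u : smul (s ++ t) u = smul s u ++ smul t u.
Proof. exact: allpairs_cat. Qed.

Lemma smul_rel1 p s t : tens_rel s t ->
  tens_rel [seq (p.1 * q.1, p.2 * q.2) | q <- s]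
           [seq (p.1 * q.1, p.2 * q.2) | q <- t].
Proof.
apply: (tens_map (f := fun a => p.1 * a) (g := fun b => p.2 * b)).
- exact: mulr0.
- exact: mulr0.
- by move=> x y; rewrite mulrDr.
- by move=> x y; rewrite mulrDr.
- move=> a c b; rewrite !mulrA -(cj c p.2) -!mulrA (mulrA p.1).
  exact: tens_bal.
Qed.

Lemma smul_rel2 p s t : tens_rel s t ->
  tens_rel [seq (q.1 * p.1, q.2 * p.2) | q <- s]
           [seq (q.1 * p.1, q.2 * p.2) | q <- t].
Proof.
apply: (tens_map (f := fun a => a * p.1) (g := fun b => b * p.2)).
- exact: mul0r.
- exact: mul0r.
- by move=> x y; rewrite mulrDl.
- by move=> x y; rewrite mulrDl.
- move=> a c b; rewrite -!mulrA (ci c p.1) !mulrA -(mulrA (j c)).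
  exact: tens_bal.
Qed.

Lemma smul_consr s p t : perm_eq (smul s (p :: t))
  ([seq (q.1 * p.1, q.2 * p.2) | q <- s] ++ smul s t).
Proof. exact/permEl/(perm_allpairs_consr _ s (fun=> p) (fun=> t)). Qed.

Lemma smul_rell s t u : tens_rel s t -> tens_rel (smul u s) (smul u t).
Proof.
move=> st; elim: u => [|p u IH]; first exact: tens_refl.
by rewrite !smul_cons; apply: tens_cat2 (smul_rel1 p st) IH.
Qed.

Lemma smul_relr s t u : tens_rel s t -> tens_rel (smul s u) (smul t u).
Proof.
move=> st; elim: u => [|p u IH].
  by rewrite /smul !allpairs0r; apply: tens_refl.
apply: tens_trans (tens_perm (smul_consr s p u)) _.
apply: tens_sym; apply: tens_trans (tens_perm (smul_consr t p u)) _.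
by apply: tens_sym; apply: tens_cat2 (smul_rel2 p st) IH.
Qed.

Lemma tmulE s t : tmul (tclass s) (tclass t) = tclass (smul s t).
Proof.
apply/tclassE; apply: tens_trans (smul_relr _ (repr_rel s)) _.
exact/smul_rell/repr_rel.
Qed.

Lemma taddA : associative tadd.
Proof.
move=> x y z; have [s ->] := tclassP x; have [t ->] := tclassP y.
by have [u ->] := tclassP z; rewrite !taddE catA.
Qed.

Lemma taddC : commutative tadd.
Proof.
move=> x y; have [s ->] := tclassP x; have [t ->] := tclassP y.
by rewrite !taddE; apply/tclassE/tens_perm/permEl/perm_catC.
Qed.

Lemma tadd0 : left_id (tclass [::]) tadd.
Proof. by move=> x; have [s ->] := tclassP x; rewrite taddE. Qed.

Lemma taddN : left_inverse (tclass [::]) topp tadd.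
Proof.
move=> x; have [s ->] := tclassP x; rewrite toppE taddE; apply/tclassE.
elim: s => [|[a b] s IH]; first exact: tens_refl.
apply: (tens_trans (t := [:: (- a, b); (a, b)] ++ (sopp s ++ s))).
  apply: tens_perm; rewrite /= perm_cons.
  by rewrite (permPl (permEl (perm_catCA _ [:: (a, b)] s))).
rewrite -[X in tens_rel _ X]cats0; apply: tens_cat2 IH.
apply: tens_trans (tens_0l b); apply: tens_sym.
by rewrite -(addNr a); apply: tens_Dl.
Qed.

HB.instance Definition _ := GRing.isZmodule.Build T taddA taddC tadd0 taddN.

Lemma tclass_cat s t : tclass (s ++ t) = tclass s + tclass t.
Proof. by rewrite -taddE. Qed.

Lemma tmulA : associative tmul.
Proof.
move=> x y z; have [s ->] := tclassP x; have [t ->] := tclassP y.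
have [u ->] := tclassP z; rewrite !tmulE; congr tclass.
elim: s => // p s IH; rewrite !smul_cons smul_cat IH; congr (_ ++ _).
elim: t {IH} => // q t IH; rewrite map_cons !smul_cons map_cat IH; congr (_ ++ _).
by rewrite -map_comp; apply: eq_map => r /=; rewrite !mulrA.
Qed.

Lemma tmul1 : left_id (pure 1 1) tmul.
Proof.
move=> x; have [s ->] := tclassP x; rewrite tmulE /smul /= cats0.
by congr tclass; rewrite -[RHS]map_id; apply: eq_map => -[a b]; rewrite !mul1r.
Qed.

Lemma tmulr1 : right_id (pure 1 1) tmul.
Proof.
move=> x; have [s ->] := tclassP x; rewrite tmulE.
congr tclass; elim: s => //= -[a b] s IH.
by rewrite smul_cons IH /= !mulr1.
Qed.

Lemma tmulDl : left_distributive tmul +%R.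
Proof.
move=> x y z; have [s ->] := tclassP x; have [t ->] := tclassP y.
have [u ->] := tclassP z; rewrite -tclass_cat !tmulE -tclass_cat.
by rewrite smul_cat.
Qed.

Lemma tmulDr : right_distributive tmul +%R.
Proof.
move=> z x y; have [s ->] := tclassP x; have [t ->] := tclassP y.
have [u ->] := tclassP z; rewrite -tclass_cat !tmulE -tclass_cat.
by apply/tclassE/tens_perm/permEl/(perm_allpairs_catr _ u (fun=> s) (fun=> t)).
Qed.

HB.instance Definition _ :=
  GRing.Zmodule_isPzRing.Build T tmulA tmul1 tmulr1 tmulDl tmulDr.

Lemma tscaleA a b x : tscale a (tscale b x) = tscale (a * b) x.
Proof.
have [s ->] := tclassP x; rewrite !tscaleE; congr tclass.
by rewrite /sscale -map_comp; apply: eq_map => p /=; rewrite scalerA.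
Qed.

Lemma tscale1 : left_id 1 tscale.
Proof.
move=> x; have [s ->] := tclassP x; rewrite tscaleE; congr tclass.
by rewrite -[RHS]map_id; apply: eq_map => -[a b]; rewrite scale1r.
Qed.

Lemma tscaleDr : right_distributive tscale +%R.
Proof.
move=> k x y; have [s ->] := tclassP x; have [t ->] := tclassP y.
by rewrite -tclass_cat !tscaleE -tclass_cat /sscale map_cat.
Qed.

Lemma tscaleDl x : {morph tscale^~ x : a b / a + b}.
Proof.
move=> k l; have [s ->] := tclassP x; rewrite !tscaleE -tclass_cat.
apply/tclassE; elim: s => [|[a b] s IH]; first exact: tens_refl.
have h : tens_rel ([:: (k *: a, b); (l *: a, b)] ++ (sscale k s ++ sscale l s))
    (sscale k ((a, b) :: s) ++ sscale l ((a, b) :: s)).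
  apply: tens_perm; rewrite /= perm_cons.
  by rewrite (permPl (permEl (perm_catCA [:: (l *: a, b)] _ _))).
apply: tens_trans h.
rewrite -[X in tens_rel X _]/([:: ((k + l) *: a, b)] ++ sscale (k + l) s).
apply: tens_cat2 IH.
by rewrite scalerDl; apply: tens_Dl.
Qed.

HB.instance Definition _ :=
  GRing.Zmodule_isLmodule.Build F T tscaleA tscale1 tscaleDr tscaleDl.

End Structure.
End Tensor.

Arguments pure {F C A B i j ci cj} a b.

Lemma center_algid (A : falgType rat) : algid 'Z({:A}) = 1.
Proof. by rewrite algid_center; apply/eqP; rewrite algid_eq1 memvf. Qed.

(* A falgType is nonzero, so no separate nontriviality condition is needed. *)
Definition simple_alg (A : falgType rat) : Prop :=
  forall I : {vspace A}, ({:A} * I <= I)%VS -> (I * {:A} <= I)%VS ->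
    I = 0%VS \/ I = {:A}%VS.

Definition center_alg (A : falgType rat) : falgType rat :=
  subvs_of 'Z({:A})%AS.

Section Center.
Variable A : falgType rat.

Lemma center_centralP (z : center_alg A) (x : A) : GRing.comm (vsval z) x.
Proof.
by have := subvsP z; rewrite memv_cap => /andP[_ /centvP/(_ _ (memvf x))].
Qed.

Definition center_incl (z : center_alg A) : A := vsval z.

Lemma center_incl_is_linear : linear center_incl.
Proof. by move=> k x y; rewrite /center_incl linearP. Qed.

Lemma center_incl_is_monoid_morphism : monoid_morphism center_incl.
Proof. by split=> //=; rewrite /center_incl /= center_algid. Qed.

HB.instance Definition _ :=
  GRing.isLinear.Build rat (center_alg A) A _ center_incl center_incl_is_linear.
HB.instance Definition _ :=
  GRing.isMonoidMorphism.Build (center_alg A) A center_incl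
    center_incl_is_monoid_morphism.

Lemma center_alg_comm (x y : center_alg A) : GRing.comm x y.
Proof. by apply: val_inj; apply: center_centralP. Qed.

End Center.

Section Extension.
Variables (K L : falgType rat) (e : {lrmorphism K -> L}).

(* Aut(L/K); an injective endomorphism is bijective since L is
   finite-dimensional. *)
Definition is_aut (f : 'AEnd(L)) : bool :=
  (lker f == 0%VS) && ((f \o linfun e)%VF == linfun e).

Definition aut := {f : 'AEnd(L) | is_aut f}.

Definition aut_fun (s : aut) : L -> L := val s.

Definition inner (s : aut) : Prop :=
  exists2 u : L, u \is a GRing.unit & forall x, aut_fun s x = u * x * u^-1.

Definition outer : Prop :=
  forall s : aut, inner s -> forall x, aut_fun s x = x.

Definition ext_img : {vspace L} := limg (linfun e).

Definition center_sub : Prop := (linfun e @: 'Z({:K}) <= 'Z({:L}))%VS.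

Lemma aut_center (s : aut) (z : center_alg L) :
  aut_fun s (vsval z) \in 'Z({:L})%VS.
Proof.
have /andP[ker0 _] := valP s.
rewrite memv_cap memvf; apply/centvP => y _.
have surj : limg (val s) = fullv by apply: lker0_limgf.
have /memv_imgP[x _ ->] : y \in limg (val s) by rewrite surj memvf.
have := subvsP z; rewrite memv_cap => /andP[_ /centvP/(_ x (memvf x)) zx].
by rewrite /aut_fun -!rmorphM /= zx.
Qed.

Hypothesis H : center_sub.

Lemma center_map_subproof (z : center_alg K) : e (vsval z) \in 'Z({:L})%VS.
Proof.
by apply: (subvP H); rewrite -[e _]lfunE; apply: memv_img; apply: subvsP.
Qed.

(* The extension Z(L)/Z(K) *)
Definition center_map (z : center_alg K) : center_alg L :=
  Subvs (center_map_subproof z).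

Lemma center_map_is_linear : linear center_map.
Proof. by move=> k x y; apply: val_inj; rewrite /= linearP. Qed.

Lemma center_map_is_monoid_morphism : monoid_morphism center_map.
Proof.
split=> [|x y]; apply: val_inj => /=; last by rewrite rmorphM.
by rewrite !center_algid rmorph1.
Qed.

HB.instance Definition _ :=
  GRing.isLinear.Build rat (center_alg K) (center_alg L) _ center_map
    center_map_is_linear.
HB.instance Definition _ :=
  GRing.isMonoidMorphism.Build (center_alg K) (center_alg L) center_map
    center_map_is_monoid_morphism.

End Extension.

Section Restriction.
Variables (K L : falgType rat) (e : {lrmorphism K -> L}) (H : center_sub e).

Definition center_fun (s : aut e) (z : center_alg L) : center_alg L :=
  Subvs (aut_center s z).

Lemma center_fun_is_linear s : linear (center_fun s).
Proof. by move=> k x y; apply: val_inj; rewrite /= /aut_fun linearP. Qed.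

HB.instance Definition _ s :=
  GRing.isLinear.Build rat (center_alg L) (center_alg L) _ (center_fun s)
    (center_fun_is_linear s).

Lemma center_fun_is_ahom s :
  ahom_in {:center_alg L} (linfun (center_fun s)).
Proof.
apply/ahom_inP; split=> [x y _ _|]; rewrite !lfunE; apply: val_inj => /=.
  by rewrite /aut_fun rmorphM.
by rewrite /aut_fun center_algid rmorph1.
Qed.

Lemma center_fun_is_aut s : is_aut (center_map H) (AHom (center_fun_is_ahom s)).
Proof.
have /andP[/lker0P finj /eqP/lfunP fe] := valP s.
apply/andP; split.
  apply/lker0P => x y; rewrite !lfunE => /(congr1 val) /finj xy.
  exact: val_inj.
apply/eqP/lfunP => z; rewrite comp_lfunE !lfunE; apply: val_inj => /=.
by have := fe (vsval z); rewrite comp_lfunE !lfunE.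
Qed.

(* The restriction map Aut(L/K) -> Aut(Z(L)/Z(K)) *)
Definition aut_restr (s : aut e) : aut (center_map H) :=
  Sub (AHom (center_fun_is_ahom s)) (center_fun_is_aut s).

Lemma aut_restrE (s : aut e) (z : center_alg L) :
  vsval (aut_fun (aut_restr s) z) = aut_fun s (vsval z).
Proof. by rewrite /aut_fun /= lfunE. Qed.

End Restriction.

Section ExtensionIso.
Variables (K L : falgType rat) (e : {lrmorphism K -> L}) (H : center_sub e).

(* Z(L) (x)_{Z(K)} K *)
Definition center_tensor :=
  tensor (i := center_map H) (j := @center_incl K)
    (fun c a => center_alg_comm (center_map H c) a) (@center_centralP K).

Definition tensor_ext_iso : Prop :=
  exists f : {rmorphism L -> center_tensor},
    [/\ scalable f, bijective f & forall y : K, f (e y) = pure 1 y].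

End ExtensionIso.

(* Main.v *)
From HB Require Import structures.
Require Import Defs.
From mathcomp Require Import all_boot all_order all_algebra all_field.
Import GRing.Theory.
Local Open Scope ring_scope.

Set Implicit Arguments.
Unset Strict Implicit.
Unset Printing Implicit Defensive.

(** The heart of the matter is that a simple algebra K is split off from any
    algebra L in which the center of K is central: L is the tensor product of
    K with Cent_L(K) over Z(K).  Instead of going through the density theorem
    and the double centralizer theorem, the proof makes the splitting explicit
    by means of the Casimir element of the trace form, which is available
    because the base field has characteristic 0.

    The trace form (x, y) |-> regtr (x * y) of K is nondegenerate: its radical
    is a two-sided ideal that avoids 1, since the trace of 1 is the dimension
    ([dual_bases_exist]).  For dual bases u, v of this form, sum u_i (x) v_i
    is the Casimir element, and T(x) = sum u_i x v_i maps L into Cent_L(K)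
    ([casimir_cent]).  On K itself T is a trace-preserving projection tau onto
    Z(K), so d = sum tau(u_i) v_i, which is central and whose trace is the
    trace of tau, that is \dim Z(K), is a unit ([casimir_weight_unit]).  As
    tau(u_i) is central in L, summing u_j u_i v_j x v_i in two orders yields
    sum_j T(v_j x) u_j = x d ([casimir_split]), hence
      x = sum_j T(v_j x) (u_j / d)                          ([split_sum]).

    This single identity gives all the implications that need an argument.
    If Cent_L(K) = Z(L), it writes every x in terms of K and Z(L)
    ([cent_gen]); the map x |-> sum_j T(v_j x) (x) (u_j / d) is inverse to
    z (x) k |-> z k ([outer_tensor_iso]); an automorphism of L over K is
    determined by its restriction to Z(L), and sigma in Aut(Z(L)/Z(K)) extends
    to x |-> sum_j sigma(T(v_j x)) (u_j / d) ([outer_restr_bij]).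

    The other steps are short.  If L/K is outer, a unit of Cent_L(K) induces
    an inner, hence trivial, automorphism over K, so it is central; and every
    element becomes a unit after subtracting a suitable rational, so the units
    of Cent_L(K) span it ([outer_cent]).  If L = Z(L) (x) K, an element that
    commutes with 1 (x) K commutes with everything because Z(L) is commutative
    ([tensor_iso_cent]).  Finally an inner automorphism is trivial on Z(L), so
    it is trivial as soon as restriction to Z(L) is injective
    ([restr_inj_outer]). *)

(** * Simple algebras *)

Lemma center_fullP (A : falgType rat) (x : A) :
  reflect (forall y, x * y = y * x) (x \in 'Z({:A})%VS).
Proof.
rewrite memv_cap memvf; apply: (iffP centvP) => [xC y|xC y _]; last exact: xC.
by rewrite xC ?memvf.
Qed.

Lemma proper_ideal0 (A : falgType rat) (simpleA : simple_alg A)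
    (I : {vspace A}) :
  (forall x k, k \in I -> x * k \in I) ->
  (forall x k, k \in I -> k * x \in I) -> 1 \notin I -> I = 0%VS.
Proof.
move=> Il Ir I1; case: (simpleA I) => // [||If]; last by rewrite If memvf in I1.
  by apply/prodvP=> x k _; apply: Il.
by apply/prodvP=> k x kI _; apply: Ir.
Qed.

(** In finite dimension an injective right multiplication is onto, so 1 has a
    preimage; injectivity again makes this one-sided inverse two-sided. *)
Lemma unit_of_rinj (A : falgType rat) (x : A) :
  (forall y, y * x = 0 -> y = 0) -> x \is a GRing.unit.
Proof.
move=> xinj; have ker0 : lker (amulr x) == 0%VS.
  apply/eqP/vspaceP=> y; rewrite memv_ker lfunE /= memv0.
  by apply/idP/idP => [/eqP/xinj->|/eqP->]; rewrite ?mul0r.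
have /memv_imgP[w _] : 1 \in limg (amulr x) by rewrite lker0_limgf ?memvf.
rewrite lfunE /= => wx; apply/unitrP; exists w; split=> //.
apply/eqP; rewrite -subr_eq0; apply/eqP/xinj.
by rewrite mulrBl -mulrA -wx mulr1 mul1r subrr.
Qed.

(** The center of a simple algebra is a field: the annihilator of a nonzero
    central z is a two-sided ideal that avoids 1. *)
Lemma simple_center_unit (A : falgType rat) (simpleA : simple_alg A) (z : A) :
  z \in 'Z({:A})%VS -> z != 0 -> z \is a GRing.unit.
Proof.
move=> /center_fullP zC z0; apply: unit_of_rinj => y /eqP yz.
have memK x : (x \in lker (amulr z)) = (x * z == 0) by rewrite memv_ker lfunE.
suff ker0 : lker (amulr z) = 0%VS by apply/eqP; rewrite -memv0 -ker0 memK.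
apply: proper_ideal0 => // [x k|x k|]; rewrite !memK ?mul1r //.
  by move=> /eqP kz; rewrite -mulrA kz mulr0.
by move=> /eqP kz; rewrite -mulrA -zC mulrA kz mul0r.
Qed.

(** * The regular trace *)

Section RegularTrace.
Variable A : falgType rat.
Local Notation b := (vbasis {:A}).
Local Notation n := (\dim {:A}).

(** Right multiplications act on row vectors of coordinates, which makes [regmx]
    multiplicative rather than anti-multiplicative. *)
Definition regmx (x : A) : 'M[rat]_n := \matrix_(i, j) coord b j (b`_i * x).

Lemma basis_expand (x : A) : x = \sum_(i < n) coord b i x *: b`_i.
Proof. by apply: coord_vbasis; apply: memvf. Qed.

Lemma regmx_is_linear : linear regmx.
Proof.
by move=> k x y; apply/matrixP=> i j; rewrite !mxE mulrDr -scalerAr linearP.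
Qed.

HB.instance Definition _ :=
  GRing.isLinear.Build rat A 'M[rat]_n _ regmx regmx_is_linear.

Lemma regmxM x y : regmx (x * y) = regmx x *m regmx y.
Proof.
apply/matrixP=> i j; rewrite !mxE mulrA {1}[b`_i * x]basis_expand.
rewrite mulr_suml linear_sum; apply: eq_bigr => k _.
by rewrite -scalerAl linearZ !mxE.
Qed.

Lemma regmx1 : regmx 1 = 1%:M.
Proof.
apply/matrixP=> i j; rewrite !mxE mulr1.
by rewrite coord_free ?(basis_free (vbasisP _)).
Qed.

Definition regtr (x : A) : rat := \tr (regmx x).

Lemma regtr_is_linear : linear_for *%R regtr.
Proof. by move=> k x y; rewrite /regtr linearP mxtraceD mxtraceZ. Qed.

HB.instance Definition _ :=
  GRing.isLinear.Build rat A rat _ regtr regtr_is_linear.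

Lemma regtrC x y : regtr (x * y) = regtr (y * x).
Proof. by rewrite /regtr !regmxM mxtrace_mulC. Qed.

Lemma regtr1_neq0 : regtr 1 != 0.
Proof.
rewrite /regtr regmx1 mxtrace1 Num.Theory.pnatr_eq0.
by rewrite -lt0n lt0n dimv_eq0 -subv0 (not_asubv0 (aspacef A)).
Qed.

(** A shift by q fails to be a unit only if q is an eigenvalue of a
    multiplication operator, and there are finitely many of those. *)
Lemma scalar_shift_unit (x : A) : exists q : rat, x - q%:A \is a GRing.unit.
Proof.
have [q qNroot] : exists q, ~~ root (char_poly (regmx x)) q.
  (* The polynomial has degree n, so one of n + 1 integers is not a root. *)
  pose s := [seq i%:R : rat | i <- iota 0 n.+1].
  have [/allP sroot|/allPn[q _ ?]] :=
    boolP (all (root (char_poly (regmx x))) s); last by exists q.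
  have := max_poly_roots (monic_neq0 (char_poly_monic (regmx x)))
    (introT allP sroot).
  suff us : uniq s by rewrite size_char_poly size_map size_iota ltnn => /(_ us).
  by rewrite map_inj_uniq ?iota_uniq //; apply: Num.Theory.mulrIn (oner_neq0 _).
exists q; apply: unit_of_rinj => y yx0.
apply: contraNeq qNroot => y0; rewrite -eigenvalue_root_char.
have yx : y * x = q *: y.
  by apply/eqP; rewrite -subr_eq0 -yx0 mulrBr -scalerAr mulr1.
apply/eigenvalueP; exists (\row_i coord b i y).
  apply/rowP=> j; have yxj := congr1 (coord b j) yx.
  rewrite linearZ /= {1}[y]basis_expand in yxj; rewrite !mxE -[RHS]yxj.
  rewrite mulr_suml linear_sum; apply: eq_bigr => k _.
  by rewrite !mxE -scalerAl linearZ.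
apply: contraNneq y0 => /rowP y0; rewrite [y]basis_expand big1 // => i _.
by have := y0 i; rewrite !mxE => ->; rewrite scale0r.
Qed.

End RegularTrace.

(** * Nondegeneracy of the trace form *)

(** Duality for the trace form is encoded by the two expansions, since these are
    what the computations with the Casimir element use. *)
Definition dual_bases (A : falgType rat) n (u v : 'I_n -> A) : Prop :=
  (forall x, x = \sum_i regtr (x * v i) *: u i) /\
  (forall x, x = \sum_i regtr (u i * x) *: v i).

Section DualBases.
Variable A : falgType rat.
Hypothesis simpleA : simple_alg A.
Local Notation b := (vbasis {:A}).
Local Notation n := (\dim {:A}).

(** The coordinates of [gram x] are the values of the trace form on x and the
    basis, so injectivity of [gram] is nondegeneracy and surjectivity yields
    the dual basis. *)
Definition gram (x : A) : A := \sum_(j < n) regtr (b`_j * x) *: b`_j.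

Lemma gram_is_linear : linear gram.
Proof.
move=> k x y; rewrite /gram scaler_sumr -big_split /=; apply: eq_bigr => j _.
by rewrite mulrDr -scalerAr linearP scalerDl scalerA.
Qed.

HB.instance Definition _ := GRing.isLinear.Build rat A A _ gram gram_is_linear.

Lemma coord_gram x j : coord b j (gram x) = regtr (b`_j * x).
Proof. by rewrite coord_sum_free ?(basis_free (vbasisP _)). Qed.

Lemma gram0P x : reflect (forall y, regtr (y * x) = 0) (gram x == 0).
Proof.
apply: (iffP eqP) => [gx0 y|trx0]; last first.
  by rewrite /gram big1 // => j _; rewrite trx0 scale0r.
rewrite [y]basis_expand mulr_suml linear_sum big1 // => j _.
by rewrite -scalerAl linearZ /= -coord_gram gx0 linear0 mulr0.
Qed.

(** The radical of the trace form is a two-sided ideal avoiding 1. *)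
Lemma lker_gram : lker (linfun gram) = 0%VS.
Proof.
have memK x : (x \in lker (linfun gram)) = (gram x == 0).
  by rewrite memv_ker lfunE.
apply: proper_ideal0 => // [x k|x k|]; rewrite !memK.
- by move=> /gram0P k0; apply/gram0P=> y; rewrite mulrA.
- by move=> /gram0P k0; apply/gram0P=> y; rewrite mulrA regtrC mulrA.
by apply/gram0P=> /(_ 1)/eqP; rewrite mulr1 (negPf (regtr1_neq0 A)).
Qed.

Lemma dual_bases_exist : exists v, dual_bases (fun i : 'I_n => b`_i) v.
Proof.
have gram_inj : injective gram.
  have /lker0P ginj : lker (linfun gram) == 0%VS by rewrite lker_gram.
  by move=> x y gxy; apply: ginj; rewrite !lfunE.
have /fin_all_exists[v gv] : forall i : 'I_n, exists v, gram v = b`_i.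
  move=> i.
  have /memv_imgP[v _ vE] : b`_i \in limg (linfun gram).
    by rewrite lker0_limgf ?memvf // lker_gram.
  by exists v; rewrite vE lfunE.
have dual (i j : 'I_n) : regtr (b`_i * v j) = (i == j)%:R.
  by rewrite -coord_gram gv coord_free ?(basis_free (vbasisP _)) // eq_sym.
exists v; split=> x.
  rewrite {1}[x]basis_expand; apply: eq_bigr => i _; congr (_ *: _).
  rewrite {2}[x]basis_expand mulr_suml linear_sum (bigD1 i) //= big1 => [|j ji].
    by rewrite -scalerAl linearZ /= dual eqxx mulr1 addr0.
  by rewrite -scalerAl linearZ /= dual (negPf ji) mulr0.
apply: gram_inj; rewrite linear_sum; apply: eq_bigr => i _.
by rewrite linearZ /= gv.
Qed.

End DualBases.

(** * The Casimir operator *)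

Lemma linear_form_sum (V : lmodType rat) (h : V -> rat) n c (x : 'I_n -> V) :
  linear_for *%R h -> h (\sum_i c i *: x i) = \sum_i c i * h (x i).
Proof.
move=> hP; have h0 : h 0 = 0.
  by have := hP (-1) 0 0; rewrite scaler0 addr0 mulN1r addNr.
by elim/big_rec2: _ => [//|i y1 y2 _ <-]; rewrite hP.
Qed.

(** Cyclicity of the trace for f : V -> W and g : W -> V, the trace being
    computed in arbitrary dual systems.  It serves both to change the basis and
    to compute the trace of a projection on its image. *)
Lemma trace_swap (V W : lmodType rat) n m
    (u : 'I_n -> V) (lambda : 'I_n -> V -> rat)
    (w : 'I_m -> W) (mu : 'I_m -> W -> rat) (f : V -> W) (g : W -> V) :
  (forall x, x = \sum_i lambda i x *: u i) ->
  (forall y, y = \sum_j mu j y *: w j) ->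
  (forall i, linear_for *%R (fun y => lambda i (g y))) ->
  (forall j, linear_for *%R (fun x => mu j (f x))) ->
  \sum_i lambda i (g (f (u i))) = \sum_j mu j (f (g (w j))).
Proof.
move=> uE wE gP fP.
transitivity (\sum_i \sum_j mu j (f (u i)) * lambda i (g (w j))).
  apply: eq_bigr => i _; rewrite {1}[f (u i)]wE.
  exact: (linear_form_sum _ _ (gP i)).
rewrite exchange_big; apply: eq_bigr => j _ /=.
rewrite {2}[g (w j)]uE (linear_form_sum _ _ (fP j)).
by apply: eq_bigr => i _; rewrite mulrC.
Qed.

Section Casimir.
Variables (K : falgType rat) (n : nat) (u v : 'I_n -> K).

Definition casimir (L : falgType rat) (e : {lrmorphism K -> L}) (x : L) : L :=
  \sum_i e (u i) * x * e (v i).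

Hypothesis uv : dual_bases u v.

Section Extension.
Variables (L : falgType rat) (e : {lrmorphism K -> L}).
Local Notation T := (casimir e).

Lemma casimir_is_linear : linear T.
Proof.
move=> k x y; rewrite /casimir scaler_sumr -big_split /=; apply: eq_bigr => i _.
by rewrite mulrDr mulrDl -scalerAr -scalerAl.
Qed.
HB.instance Definition _ :=
  GRing.isLinear.Build rat L L _ T casimir_is_linear.

(** This is the invariance of the Casimir element sum u_i (x) v_i: both sides
    expand to sum regtr (c u_i v_j) u_j (x) v_i. *)
Lemma casimir_shift c x :
  \sum_i e (c * u i) * x * e (v i) = \sum_i e (u i) * x * e (v i * c).
Proof.
have [uE vE] := uv.
transitivity (\sum_i \sum_j regtr (c * u i * v j) *: (e (u j) * x * e (v i))).
  apply: eq_bigr => i _; rewrite {1}[c * u i]uE linear_sum !mulr_suml.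
  by apply: eq_bigr => j _; rewrite linearZ -!scalerAl.
rewrite exchange_big; apply: eq_bigr => j _ /=.
rewrite [v j * c]vE linear_sum mulr_sumr; apply: eq_bigr => i _.
by rewrite linearZ -scalerAr /= -mulrA regtrC mulrA.
Qed.

Lemma casimir_shift_mid c x :
  \sum_i e (u i * c) * x * e (v i) = \sum_i e (u i) * x * e (c * v i).
Proof.
have [uE vE] := uv.
transitivity (\sum_i \sum_j regtr (u i * c * v j) *: (e (u j) * x * e (v i))).
  apply: eq_bigr => i _; rewrite {1}[u i * c]uE linear_sum !mulr_suml.
  by apply: eq_bigr => j _; rewrite linearZ -!scalerAl.
rewrite exchange_big; apply: eq_bigr => j _ /=.
rewrite [c * v j]vE linear_sum mulr_sumr; apply: eq_bigr => i _.
by rewrite linearZ -scalerAr /= mulrA.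
Qed.

Lemma casimir_comm c x : e c * T x = T x * e c.
Proof.
rewrite mulr_sumr mulr_suml.
transitivity (\sum_i e (c * u i) * x * e (v i)).
  by apply: eq_bigr => i _; rewrite rmorphM !mulrA.
by rewrite casimir_shift; apply: eq_bigr => i _; rewrite rmorphM !mulrA.
Qed.

Lemma casimir_cent x : T x \in 'C(ext_img e)%VS.
Proof.
by apply/centvP=> _ /memv_imgP[c _ ->]; rewrite lfunE casimir_comm.
Qed.

(** Together with the invariance, this symmetry is what makes the weight sum
    tau(u_i) v_i below central. *)
Lemma casimir_tracial c x : T (e c * x) = T (x * e c).
Proof.
transitivity (\sum_i e (u i * c) * x * e (v i)).
  by apply: eq_bigr => i _; rewrite rmorphM !mulrA.
rewrite casimir_shift_mid.
by apply: eq_bigr => i _; rewrite rmorphM !mulrA.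
Qed.

End Extension.

Definition ext_id : {lrmorphism K -> K} := [the {lrmorphism K -> K} of idfun].
Local Notation tau := (casimir ext_id).

Lemma casimir_center x : tau x \in 'Z({:K})%VS.
Proof. by apply/center_fullP=> y; apply/esym/(casimir_comm ext_id). Qed.

Lemma casimir_img (L : falgType rat) (e : {lrmorphism K -> L}) x :
  casimir e (e x) = e (tau x).
Proof.
by rewrite /casimir rmorph_sum; apply: eq_bigr => i _; rewrite !rmorphM.
Qed.

Lemma casimirMl z x : z \in 'Z({:K})%VS -> tau (z * x) = z * tau x.
Proof.
move=> /center_fullP zC; rewrite /casimir mulr_sumr.
by apply: eq_bigr => i _; rewrite !mulrA -zC.
Qed.

(** The trace of right multiplication by x, computed in the dual bases, is
    sum regtr (u_i x v_i). *)
Lemma regtr_casimir x : regtr (tau x) = regtr x.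
Proof.
have [uE vE] := uv.
rewrite linear_sum /= (trace_swap (f := fun y => y * x) (g := idfun)
  (mu := fun j => coord (vbasis {:K}) j) uE (@basis_expand K)).
- by rewrite /regtr /mxtrace; apply: eq_bigr => j _; rewrite mxE.
- by move=> i k y z /=; rewrite mulrDl -scalerAl linearP.
- by move=> j k y z /=; rewrite mulrDl -scalerAl linearP.
Qed.

(** By linearity over the center it suffices that t = tau 1 is 1.  Otherwise
    t - 1 is invertible in the center, and trace preservation applied to
    z = (t - 1)^-1 gives regtr (z t) = regtr z, so regtr 1 = 0. *)
Lemma casimir_id_center (simpleK : simple_alg K) z :
  z \in 'Z({:K})%VS -> tau z = z.
Proof.
move=> zZ; rewrite -[z in LHS]mulr1 casimirMl //.
suff -> : tau 1 = 1 by rewrite mulr1.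
apply/eqP; rewrite -subr_eq0; apply: contraT => t0.
have tZ : tau 1 - 1 \in 'Z({:K})%VS.
  by rewrite rpredB ?casimir_center // -(center_algid K) memv_algid.
have tU := simple_center_unit simpleK tZ t0.
have tVZ : (tau 1 - 1)^-1 \in 'Z({:K})%VS by rewrite memvV.
suff : regtr (1 : K) = 0 by move/eqP; rewrite (negPf (regtr1_neq0 K)).
rewrite -(mulVr tU) mulrBr mulr1 -casimirMl // mulr1 linearB /=.
by rewrite regtr_casimir subrr.
Qed.

(** The factor by which reassembling x from its Casimir images is off; for a
    matrix algebra of size n it is the scalar n^-2. *)
Definition casimir_weight : K := \sum_i tau (u i) * v i.
Local Notation d := casimir_weight.

Lemma casimir_weight_center : d \in 'Z({:K})%VS.
Proof.
apply/center_fullP=> c.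
(* Exposes the sum over i, to which the Casimir symmetries apply. *)
have expand (f g : 'I_n -> K) :
    \sum_i tau (f i) * g i = \sum_l u l * \sum_i f i * v l * g i.
  under eq_bigr do rewrite mulr_suml.
  rewrite exchange_big; apply: eq_bigr => l _; rewrite mulr_sumr.
  by apply: eq_bigr => i _; rewrite !mulrA.
transitivity (\sum_i tau (c * u i) * v i).
  rewrite mulr_suml; under eq_bigr do rewrite -mulrA.
  rewrite !expand; apply: eq_bigr => l _; congr (_ * _).
  exact/esym/(casimir_shift ext_id).
transitivity (\sum_i tau (u i * c) * v i).
  by apply: eq_bigr => i _; rewrite (casimir_tracial ext_id c).
transitivity (\sum_i tau (u i) * (c * v i)).
  rewrite !expand; apply: eq_bigr => l _; congr (_ * _).
  exact: (casimir_shift_mid ext_id).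
rewrite mulr_sumr; apply: eq_bigr => i _; rewrite !mulrA; congr (_ * _).
exact/esym/(casimir_comm ext_id).
Qed.

(** Expanded in the dual bases, this trace is the trace of the operator tau,
    a projection onto the center. *)
Lemma regtr_casimir_weight (simpleK : simple_alg K) :
  regtr d = (\dim 'Z({:K}))%:R.
Proof.
have [uE vE] := uv; pose w := vbasis {:center_alg K}.
have projP x : vsval (vsproj 'Z({:K}) (tau x)) = tau x.
  by rewrite vsprojK ?casimir_center.
have swap := trace_swap (f := fun y => vsproj 'Z({:K}) (tau y)) (g := vsval)
  (lambda := fun i x => regtr (x * v i)) (mu := fun j => coord w j)
  uE (@basis_expand _).
rewrite linear_sum /=.
transitivity (\sum_i regtr (vsval (vsproj 'Z({:K}) (tau (u i))) * v i)).
  by apply: eq_bigr => i _; rewrite projP.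
rewrite swap => [|i k x y|j k x y].
- transitivity (\sum_(j < \dim {:center_alg K}) (1 : rat)).
    apply: eq_bigr => j _; rewrite casimir_id_center ?subvsP // vsvalK.
    by rewrite coord_free ?eqxx ?(basis_free (vbasisP _)).
  by rewrite sumr_const card_ord dimvf.
- by rewrite linearP mulrDl -scalerAl linearP.
- by rewrite !linearP.
Qed.

Lemma casimir_weight_unit (simpleK : simple_alg K) : d \is a GRing.unit.
Proof.
apply: simple_center_unit casimir_weight_center _ => //.
apply: contraTneq isT => d0; have := regtr_casimir_weight simpleK.
rewrite d0 linear0 => /esym/eqP; rewrite Num.Theory.pnatr_eq0.
by rewrite -leqn0 leqNgt adim_gt0.
Qed.

(** Since the images of u commute with values of the Casimir operator, the left
    side is sum u_l u_i v_l x v_i; summing over l first yields the central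
    factors tau (u_i), which move past x. *)
Lemma casimir_split (L : falgType rat) (e : {lrmorphism K -> L}) x :
  center_sub e -> \sum_i casimir e (e (v i) * x) * e (u i) = x * e d.
Proof.
move=> ZKL; transitivity (\sum_i e (tau (u i)) * x * e (v i)).
  under eq_bigr do rewrite -casimir_comm mulr_sumr.
  rewrite exchange_big; apply: eq_bigr => i _ /=.
  rewrite rmorph_sum !mulr_suml; apply: eq_bigr => l _.
  by rewrite !rmorphM !mulrA.
rewrite rmorph_sum mulr_sumr; apply: eq_bigr => i _.
rewrite rmorphM mulrA; congr (_ * _).
have : e (tau (u i)) \in 'Z({:L})%VS.
  by apply: (subvP ZKL); rewrite -[e _]lfunE memv_img ?casimir_center.
by move=> /center_fullP ->.
Qed.

End Casimir.

(** * Tensor products *)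

Section TensorTheory.
Variables (F : fieldType) (C A B : algType F).
Variables (i : {lrmorphism C -> A}) (j : {lrmorphism C -> B}).
Variables (ci : forall c a, GRing.comm (i c) a).
Variables (cj : forall c b, GRing.comm (j c) b).
Local Notation T := (tensor ci cj).
Local Notation tcl := (@tclass _ _ _ _ i j ci cj).
Local Notation "a ⊗ b" := (@pure _ _ _ _ i j ci cj a b) (at level 40).

Lemma tclass_sum s : tcl s = \sum_(p <- s) (p.1 ⊗ p.2).
Proof.
elim: s => [|[a b] s IH]; first by rewrite big_nil.
by rewrite big_cons -IH -tclass_cat.
Qed.

Lemma tensor_sum_pure (x : T) : exists s, x = \sum_(p <- s) (p.1 ⊗ p.2).
Proof. by have [s ->] := tclassP x; exists s; rewrite tclass_sum. Qed.

Lemma pureDl a a' b : (a + a') ⊗ b = (a ⊗ b) + (a' ⊗ b).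
Proof. by rewrite -tclass_cat; apply/tclassE/tens_Dl. Qed.

Lemma pureDr a b b' : a ⊗ (b + b') = (a ⊗ b) + (a ⊗ b').
Proof. by rewrite -tclass_cat; apply/tclassE/tens_Dr. Qed.

Lemma pure0r a : a ⊗ 0 = 0.
Proof. exact/tclassE/tens_0r. Qed.

Lemma pure_sumr a n (b : 'I_n -> B) : a ⊗ (\sum_l b l) = \sum_l (a ⊗ b l).
Proof. by elim/big_rec2: _ => [|l x y _ <-]; rewrite ?pure0r ?pureDr. Qed.

Lemma pure_balanced a c b : (a * i c) ⊗ b = a ⊗ (j c * b).
Proof. exact/tclassE/tens_bal. Qed.

Lemma pureM a b a' b' : (a ⊗ b) * (a' ⊗ b') = (a * a') ⊗ (b * b').
Proof. exact: tmulE. Qed.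

Section Lift.
Variable L : algType F.
Variables (phi : {lrmorphism A -> L}) (psi : {lrmorphism B -> L}).
Hypothesis phi_psi : forall c, phi (i c) = psi (j c).
Hypothesis comm_phi_psi : forall a b, GRing.comm (phi a) (psi b).

Definition tensor_eval (s : seq (A * B)) : L := \sum_(p <- s) phi p.1 * psi p.2.

Lemma tensor_eval_rel s t : tens_rel i j s t -> tensor_eval s = tensor_eval t.
Proof.
rewrite /tensor_eval; elim=> {s t} //=.
- by move=> s t u _ -> _ ->.
- by move=> s t st; apply: perm_big.
- by move=> s t u _ st; rewrite !big_cat st.
- by move=> b; rewrite big_nil big_seq1 rmorph0 mul0r.
- by move=> a; rewrite big_nil big_seq1 rmorph0 mulr0.
- by move=> a a' b; rewrite !big_cons !big_nil !addr0 rmorphD mulrDl.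
- by move=> a b b'; rewrite !big_cons !big_nil !addr0 rmorphD mulrDr.
- by move=> a c b; rewrite !big_seq1 /= !rmorphM /= phi_psi mulrA.
Qed.

(** The universal property: algebra maps out of A and B that agree on C and have
    commuting images factor through the tensor product. *)
Definition tensor_lift (x : T) : L := tensor_eval (repr x).

Lemma tensor_lift_class s : tensor_lift (tcl s) = tensor_eval s.
Proof. exact/tensor_eval_rel/repr_rel. Qed.

Lemma tensor_lift_pure a b : tensor_lift (a ⊗ b) = phi a * psi b.
Proof. by rewrite tensor_lift_class /tensor_eval big_seq1. Qed.

Lemma tensor_lift_is_linear : linear tensor_lift.
Proof.
move=> k x y; have [s ->] := tclassP x; have [t ->] := tclassP y.
have -> : k *: tcl s = tcl (sscale k s) by apply: tscaleE.
rewrite -tclass_cat !tensor_lift_class /tensor_eval big_cat big_map scaler_sumr.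
by congr (_ + _); apply: eq_bigr => p _; rewrite linearZ scalerAl.
Qed.

HB.instance Definition _ :=
  GRing.isLinear.Build F T L _ tensor_lift tensor_lift_is_linear.

Lemma tensor_lift_is_monoid_morphism : monoid_morphism tensor_lift.
Proof.
split=> [|x y].
  rewrite -[X in tensor_lift X]/(1 ⊗ 1) tensor_lift_pure.
  by rewrite !rmorph1 mulr1.
have [s ->] := tensor_sum_pure x; have [t ->] := tensor_sum_pure y.
rewrite mulr_suml !linear_sum mulr_suml; apply: eq_bigr => p _.
rewrite mulr_sumr !linear_sum mulr_sumr; apply: eq_bigr => q _.
rewrite pureM /= !tensor_lift_pure !rmorphM -!mulrA; congr (_ * _).
by rewrite !mulrA (comm_phi_psi q.1).
Qed.

End Lift.
End TensorTheory.

(** * Centralizers and automorphisms of an extension *)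

Section Extension.
Variables (K L : falgType rat) (e : {lrmorphism K -> L}).

Lemma cent_extP (x : L) :
  reflect (forall y, x * e y = e y * x) (x \in 'C(ext_img e)%VS).
Proof.
apply: (iffP centvP) => [xC y|xC _ /memv_imgP[y _ ->]].
  by rewrite xC // -[e y]lfunE memv_img ?memvf.
by rewrite lfunE xC.
Qed.

Lemma center_sub_cent : ('Z({:L}) <= 'C(ext_img e))%VS.
Proof. by apply/subvP=> x /center_fullP xZ; apply/cent_extP=> y. Qed.

Lemma cent_center_sub : ('C(ext_img e) = 'Z({:L}))%VS -> center_sub e.
Proof.
move=> CZ; apply/subvP=> _ /memv_imgP[z /center_fullP zZ ->]; rewrite -CZ lfunE.
by apply/cent_extP=> y; rewrite -!rmorphM zZ.
Qed.

Lemma aut_base (s : aut e) y : aut_fun s (e y) = e y.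
Proof.
have /andP[_ /eqP/lfunP/(_ y)] := valP s.
by rewrite comp_lfunE !lfunE.
Qed.

Lemma aut_ext (s t : aut e) : aut_fun s =1 aut_fun t -> s = t.
Proof. by move=> st; do 2!apply: val_inj; apply/lfunP. Qed.

Section AutOfMorphism.
Variable f : {lrmorphism L -> L}.
Hypotheses (f_inj : injective f) (fe : forall y, f (e y) = e y).

Lemma morphism_is_aut : is_aut e (linfun_ahom f).
Proof.
rewrite /is_aut; apply/andP; split.
  by apply/lker0P=> x y; rewrite !lfunE => /f_inj.
by apply/eqP/lfunP=> y; rewrite comp_lfunE !lfunE /= fe.
Qed.

Definition aut_of_morphism : aut e := Sub (linfun_ahom f) morphism_is_aut.

Lemma aut_of_morphismE x : aut_fun aut_of_morphism x = f x.
Proof. by rewrite /aut_fun /= lfunE. Qed.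

End AutOfMorphism.

Section Conjugation.
Variable u : L.
Hypothesis u_unit : u \is a GRing.unit.

Definition conj_unit x := u * x * u^-1.

Lemma conj_unit_is_linear : linear conj_unit.
Proof.
by move=> k x y; rewrite /conj_unit mulrDr mulrDl -scalerAr -scalerAl.
Qed.

Lemma conj_unit_is_monoid_morphism : monoid_morphism conj_unit.
Proof.
split=> [|x y]; rewrite /conj_unit; first by rewrite mulr1 mulrV.
by rewrite !mulrA mulrVK.
Qed.

HB.instance Definition _ :=
  GRing.isLinear.Build rat L L _ conj_unit conj_unit_is_linear.
HB.instance Definition _ :=
  GRing.isMonoidMorphism.Build L L conj_unit conj_unit_is_monoid_morphism.

Lemma conj_aut : u \in 'C(ext_img e)%VS ->
  exists s : aut e, aut_fun s =1 conj_unit.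
Proof.
move=> /cent_extP uC.
suff [inj fe] : injective conj_unit /\ forall y, conj_unit (e y) = e y.
  by exists (aut_of_morphism inj fe) => x; rewrite aut_of_morphismE.
split=> [x y|y]; rewrite /conj_unit; last by rewrite uC mulrK.
have uV_unit : u^-1 \is a GRing.unit by rewrite unitrV.
by move/(mulIr uV_unit)/(mulrI u_unit).
Qed.

End Conjugation.

(** Conjugation by a unit of the centralizer is an inner automorphism over K,
    so such units are central; rational shifts reduce to units. *)
Lemma outer_cent : outer e -> ('C(ext_img e) = 'Z({:L}))%VS.
Proof.
move=> out; apply: subv_anti; rewrite center_sub_cent andbT.
apply/subvP=> x xC; have [q uU] := scalar_shift_unit x; set u := x - _ in uU.
have uC : u \in 'C(ext_img e)%VS.
  by rewrite rpredB ?rpredZ //; apply/cent_extP=> y; rewrite mul1r mulr1.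
have [s sE] := conj_aut uU uC.
have uZ : u \in 'Z({:L})%VS.
  apply/center_fullP=> y; have <- : aut_fun s y = y by apply: out; exists u.
  by rewrite {2}sE /conj_unit mulrVK // out //; exists u.
rewrite -(subrK q%:A x) rpredD // rpredZ //.
by apply/center_fullP=> y; rewrite mul1r mulr1.
Qed.

(** The elements commuting with a given x form a subalgebra, which is everything
    once it contains K and Z(L). *)
Lemma gen_cent : agenv (ext_img e + 'Z({:L})) = {:L}%VS ->
  ('C(ext_img e) = 'Z({:L}))%VS.
Proof.
move=> gen; apply: subv_anti; rewrite center_sub_cent andbT.
apply/subvP=> x xC; apply/center_fullP=> y.
apply/esym/cent1vP; move: y (memvf y); apply/subvP; rewrite -gen.
have genC : (ext_img e + 'Z({:L}) <= 'C[x])%VS.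
  rewrite subv_add !subv_cent1 xC /=.
  by apply/centvP=> z /center_fullP ->.
apply: agenv_sub_modl; last by rewrite prodv_sub.
by rewrite -memvE; apply: cent1v1.
Qed.

(** * The splitting of L over a simple subalgebra *)

Section Splitting.
Hypothesis simpleK : simple_alg K.
Variables (n : nat) (u v : 'I_n -> K).
Hypothesis uv : dual_bases u v.
Local Notation d := (casimir_weight u v).
Local Notation tau := (casimir u v (ext_id K)).

Definition split_coef (i : 'I_n) (x : L) : L := casimir u v e (e (v i) * x).
Definition split_base (i : 'I_n) : K := u i / d.
Local Notation w := split_base.

Lemma split_coef_is_linear i : linear (split_coef i).
Proof. by move=> k x y; rewrite /split_coef mulrDr -scalerAr linearP. Qed.
HB.instance Definition _ i :=
  GRing.isLinear.Build rat L L _ (split_coef i) (split_coef_is_linear i).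

Lemma split_coef_cent i x : split_coef i x \in 'C(ext_img e)%VS.
Proof. exact: casimir_cent. Qed.

(** This exhibits L as K times the centralizer of K, with explicit coefficients;
    every structural consequence below is read off from it. *)
Lemma split_sum (ZKL : center_sub e) x :
  x = \sum_i split_coef i x * e (w i).
Proof.
have dU := casimir_weight_unit uv simpleK.
apply: (mulIr (rmorph_unit e dU)); rewrite -casimir_split // mulr_suml.
by apply: eq_bigr => i _; rewrite -mulrA -rmorphM mulrVK.
Qed.

Lemma cent_gen : ('C(ext_img e) = 'Z({:L}))%VS ->
  center_sub e /\ agenv (ext_img e + 'Z({:L})) = {:L}%VS.
Proof.
move=> CZ; have ZKL := cent_center_sub CZ; split=> //.
apply/eqP; rewrite eqEsubv subvf; apply/subvP=> x _; rewrite [x](split_sum ZKL).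
apply: rpred_sum => i _; rewrite agenvE memvM //=.
  apply: (subvP (sub_agenv _)); apply: (subvP (addvSr _ _)).
  by rewrite -CZ split_coef_cent.
apply: (subvP (sub_agenv _)); apply: (subvP (addvSl _ _)).
by rewrite -[e _]lfunE memv_img ?memvf.
Qed.

Lemma casimirMr x z : z \in 'Z({:L})%VS ->
  casimir u v e (x * z) = casimir u v e x * z.
Proof.
move=> /center_fullP zZ; rewrite mulr_suml; apply: eq_bigr => i _.
by rewrite -zZ mulrA -zZ -!mulrA zZ.
Qed.

Lemma split_coef_mul i z k : z \in 'Z({:L})%VS ->
  split_coef i (z * e k) = z * e (tau (v i * k)).
Proof.
move=> zZ; have /center_fullP zC := zZ.
by rewrite /split_coef zC mulrA casimirMr // -rmorphM casimir_img zC.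
Qed.

End Splitting.

End Extension.

(** * Extensions in which Z(L) centralizes K and nothing else does *)

Section OuterExtension.
Variables (K L : falgType rat) (e : {lrmorphism K -> L}).
Hypothesis simpleK : simple_alg K.
Variables (n : nat) (u v : 'I_n -> K).
Hypothesis uv : dual_bases u v.
Hypotheses (H : center_sub e) (CZ : ('C(ext_img e) = 'Z({:L}))%VS).
Local Notation coef := (split_coef e u v).
Local Notation w := (split_base u v).
Local Notation tau := (casimir u v (ext_id K)).

Definition central_coef i (x : L) : center_alg L := vsproj 'Z({:L}) (coef i x).

Lemma central_coef_is_linear i : linear (central_coef i).
Proof. by move=> k x y; rewrite /central_coef !linearP. Qed.
HB.instance Definition _ i := GRing.isLinear.Build rat L (center_alg L) _
  (central_coef i) (central_coef_is_linear i).

Lemma val_central_coef i x : vsval (central_coef i x) = coef i x.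
Proof. by apply: vsprojK; have := split_coef_cent e uv i x; rewrite CZ. Qed.

Lemma central_sum x : x = \sum_i vsval (central_coef i x) * e (w i).
Proof.
rewrite [LHS](split_sum simpleK uv H x).
by apply: eq_bigr => i _; rewrite val_central_coef.
Qed.

Lemma center_sub_id : center_sub (ext_id K).
Proof. by apply/subvP=> _ /memv_imgP[z zZ ->]; rewrite lfunE. Qed.

Lemma split_sum_id k : k = \sum_i tau (v i * k) * w i.
Proof. exact: (split_sum simpleK uv center_sub_id k). Qed.

Definition center_tau (k : K) : center_alg K := vsproj 'Z({:K}) (tau k).

Lemma val_center_tau k : vsval (center_tau k) = tau k.
Proof. by apply: vsprojK; apply: casimir_center. Qed.

Lemma central_coef_mul i (z : center_alg L) k :
  central_coef i (vsval z * e k) = z * center_map H (center_tau (v i * k)).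
Proof.
apply: val_inj; rewrite [LHS]val_central_coef split_coef_mul ?subvsP //.
by congr (_ * e _); rewrite val_center_tau.
Qed.

(** On a product z k the splitting can be undone inside any pairing F balanced
    over Z(K): the coefficients are z tau(v_i k), the factors tau(v_i k) move to
    the right, and k is reassembled by the splitting of K itself.  It is used
    with F the pure tensor and with F a b = sigma(a) b. *)
Lemma central_sum_mul (R : zmodType) (F : center_alg L -> K -> R) z k :
  (forall a b b', F a (b + b') = F a b + F a b') ->
  (forall a c b, F (a * center_map H c) b = F a (vsval c * b)) ->
  \sum_i F (central_coef i (vsval z * e k)) (w i) = F z k.
Proof.
move=> FD FC; have F0 a : F a 0 = 0.
  by apply: (addrI (F a 0)); rewrite -FD !addr0.
rewrite [in RHS](split_sum_id k).
transitivity (\sum_i F z (tau (v i * k) * w i)).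
  by apply: eq_bigr => i _; rewrite central_coef_mul FC val_center_tau.
by elim/big_rec2: _ => [|i x y _ ->]; rewrite ?F0 ?FD.
Qed.

Local Notation T := (center_tensor H).

Definition incl_center : {lrmorphism center_alg L -> L} :=
  [the {lrmorphism center_alg L -> L} of @center_incl L].

Lemma incl_center_map c : incl_center (center_map H c) = e (center_incl c).
Proof. by []. Qed.

Lemma incl_center_comm z k : GRing.comm (incl_center z) (e k).
Proof. exact: center_centralP. Qed.

Definition from_tensor : T -> L :=
  @tensor_lift _ _ _ _ (center_map H) (@center_incl K)
    (fun c a => center_alg_comm (center_map H c) a) (@center_centralP K) _
    incl_center e.

Lemma from_tensor_is_linear : linear from_tensor.
Proof. exact: tensor_lift_is_linear incl_center_map. Qed.

Lemma from_tensor_is_monoid_morphism : monoid_morphism from_tensor.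
Proof.
exact: tensor_lift_is_monoid_morphism incl_center_map incl_center_comm.
Qed.

HB.instance Definition _ :=
  GRing.isLinear.Build rat T L _ from_tensor from_tensor_is_linear.
HB.instance Definition _ :=
  GRing.isMonoidMorphism.Build T L from_tensor from_tensor_is_monoid_morphism.

Lemma from_tensor_pure (z : center_alg L) k :
  from_tensor (pure z k) = vsval z * e k.
Proof. exact: (tensor_lift_pure _ _ incl_center_map). Qed.

Definition to_tensor (x : L) : T := \sum_i pure (central_coef i x) (w i).

Lemma to_tensorD : {morph to_tensor : x y / x + y}.
Proof.
move=> x y; rewrite /to_tensor -big_split; apply: eq_bigr => i _ /=.
by rewrite raddfD pureDl.
Qed.

Lemma to_tensorK : cancel to_tensor from_tensor.
Proof.
move=> x; rewrite [RHS]central_sum linear_sum.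
by apply: eq_bigr => i _; rewrite /= from_tensor_pure.
Qed.

Lemma from_tensorK : cancel from_tensor to_tensor.
Proof.
move=> t; have [s ->] : exists s, t = \sum_(p <- s) pure p.1 p.2.
  exact: tensor_sum_pure.
rewrite linear_sum; elim: s => [|[z k] s IH].
  rewrite !big_nil /to_tensor big1 // => i _.
  by rewrite linear0; exact/tclassE/tens_0l.
rewrite !big_cons to_tensorD IH /= from_tensor_pure; congr (_ + _).
apply: (central_sum_mul (F := fun a b => pure a b)) => [a b b'|a c b].
  exact: pureDr.
exact: pure_balanced.
Qed.

Lemma outer_tensor_iso : tensor_ext_iso H.
Proof.
have addf := can2_zmod_morphism from_tensorK to_tensorK.
have mulf := can2_monoid_morphism from_tensorK to_tensorK.
pose f : {rmorphism L -> T} := HB.pack to_tensor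
  (GRing.isZmodMorphism.Build L T to_tensor addf)
  (GRing.isMonoidMorphism.Build L T to_tensor mulf).
exists f; split=> [k x||y].
- exact: (can2_scalable from_tensorK to_tensorK).
- by exists from_tensor; [apply: to_tensorK|apply: from_tensorK].
- rewrite -[RHS]from_tensorK from_tensor_pure.
  by rewrite [vsval 1]center_algid mul1r.
Qed.

Section RestrictionSurjective.
Variable sigma : aut (center_map H).

(** This is sigma (x) id transported to L along the tensor decomposition. *)
Definition aut_lift (x : L) : L :=
  \sum_i vsval (aut_fun sigma (central_coef i x)) * e (w i).

Lemma aut_lift_is_linear : linear aut_lift.
Proof.
move=> k x y; rewrite /aut_lift scaler_sumr -big_split.
apply: eq_bigr => i _ /=.
by rewrite /aut_fun !linearP mulrDl scalerAl.
Qed.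

HB.instance Definition _ :=
  GRing.isLinear.Build rat L L _ aut_lift aut_lift_is_linear.

Lemma aut_lift_mul (z : center_alg L) k :
  aut_lift (vsval z * e k) = vsval (aut_fun sigma z) * e k.
Proof.
apply: (central_sum_mul (F := fun a b => vsval (aut_fun sigma a) * e b)).
  by move=> a b b'; rewrite rmorphD mulrDr.
move=> a c b; rewrite /aut_fun rmorphM rmorphM /= mulrA; congr (_ * _ * _).
by rewrite -[val sigma _]/(aut_fun sigma _) aut_base.
Qed.

Lemma aut_lift_is_monoid_morphism : monoid_morphism aut_lift.
Proof.
split=> [|x y].
  have := aut_lift_mul 1 1; rewrite [aut_fun _ _](rmorph1 (val sigma)).
  by rewrite [vsval 1]center_algid rmorph1 mulr1.
(* Products z k span L, so multiplicativity need only be seen on them. *)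
have lift_pureM (z z' : center_alg L) k k' :
    aut_lift (vsval z * e k * (vsval z' * e k')) =
    aut_lift (vsval z * e k) * aut_lift (vsval z' * e k').
  have swap (a a' : center_alg L) :
      vsval a * e k * (vsval a' * e k') = vsval (a * a') * e (k * k').
    rewrite rmorphM -[vsval (a * a')]/(vsval a * vsval a') -!mulrA.
    by congr (_ * _); rewrite !mulrA center_centralP.
  by rewrite swap !aut_lift_mul swap /aut_fun rmorphM.
rewrite [x]central_sum [y]central_sum mulr_suml !linear_sum mulr_suml.
apply: eq_bigr => i _; rewrite mulr_sumr !linear_sum mulr_sumr.
by apply: eq_bigr => j _; apply: lift_pureM.
Qed.

HB.instance Definition _ :=
  GRing.isMonoidMorphism.Build L L aut_lift aut_lift_is_monoid_morphism.

Lemma aut_lift_center (z : center_alg L) :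
  aut_lift (vsval z) = vsval (aut_fun sigma z).
Proof. by have := aut_lift_mul z 1; rewrite rmorph1 !mulr1. Qed.

Lemma aut_lift_base y : aut_lift (e y) = e y.
Proof.
have := aut_lift_mul 1 y; rewrite [aut_fun _ _](rmorph1 (val sigma)).
by rewrite [vsval 1]center_algid !mul1r.
Qed.

(** The kernel is a proper two-sided ideal of the simple algebra L. *)
Lemma aut_lift_inj (simpleL : simple_alg L) : injective aut_lift.
Proof.
have memK x : (x \in lker (linfun aut_lift)) = (aut_lift x == 0).
  by rewrite memv_ker lfunE.
suff ker0 : lker (linfun aut_lift) = 0%VS.
  have /lker0P inj : lker (linfun aut_lift) == 0%VS by rewrite ker0.
  by move=> x y xy; apply: inj; rewrite !lfunE.
apply: proper_ideal0 => // [x k|x k|]; rewrite !memK ?rmorphM /=.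
- by move=> /eqP->; rewrite mulr0.
- by move=> /eqP->; rewrite mul0r.
by rewrite rmorph1 oner_eq0.
Qed.

End RestrictionSurjective.

Lemma outer_restr_bij (simpleL : simple_alg L) : bijective (aut_restr H).
Proof.
have restr_sum (s : aut e) x : aut_fun s x =
    \sum_i vsval (aut_fun (aut_restr H s) (central_coef i x)) * e (w i).
  rewrite {1}[x]central_sum [LHS](linear_sum (val s)); apply: eq_bigr => i _.
  rewrite [LHS](rmorphM (val s)); congr (_ * _); last exact: aut_base.
  exact/esym/aut_restrE.
have restr_inj : injective (aut_restr H).
  by move=> s t st; apply: aut_ext => x; rewrite !restr_sum st.
pose lift sigma := aut_of_morphism (aut_lift_inj (sigma := sigma) simpleL)
  (aut_lift_base sigma).
have liftK : cancel lift (aut_restr H).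
  move=> sigma; apply: aut_ext => z; apply: val_inj.
  rewrite [LHS]aut_restrE aut_of_morphismE; exact: aut_lift_center.
by exists lift => // s; apply: restr_inj; rewrite liftK.
Qed.

End OuterExtension.

(** * Back from the tensor product and from restriction *)

Section Converse.
Variables (K L : falgType rat) (e : {lrmorphism K -> L}) (H : center_sub e).
Local Notation T := (center_tensor H).

Lemma pure_center_comm (z : center_alg L) (t : T) : GRing.comm (pure z 1 : T) t.
Proof.
have [s ->] : exists s, t = \sum_(p <- s) pure p.1 p.2.
  exact: tensor_sum_pure.
rewrite /GRing.comm mulr_sumr mulr_suml; apply: eq_bigr => p _.
by rewrite !pureM mul1r mulr1 (center_alg_comm z).
Qed.

(** For x centralizing K, f x commutes with 1 (x) k, and z (x) 1 is central, so
    f x commutes with all pure tensors. *)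
Lemma tensor_iso_cent : tensor_ext_iso H -> ('C(ext_img e) = 'Z({:L}))%VS.
Proof.
move=> [f [_ f_bij fe]]; apply: subv_anti; rewrite center_sub_cent andbT.
apply/subvP=> x /cent_extP xC; apply/center_fullP=> y; apply: (bij_inj f_bij).
have [s fyE] : exists s, f y = \sum_(p <- s) pure p.1 p.2.
  exact: tensor_sum_pure.
rewrite !rmorphM fyE mulr_sumr mulr_suml; apply: eq_bigr => -[z k] _ /=.
have -> : pure z k = (pure z 1 : T) * f (e k) by rewrite fe pureM mulr1 mul1r.
rewrite mulrA -[f x * _](pure_center_comm z) -!mulrA; congr (_ * _).
by rewrite -!rmorphM xC.
Qed.

(** Conjugation fixes the center pointwise, so it restricts to the identity. *)
Lemma restr_inj_outer : injective (aut_restr H) -> outer e.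
Proof.
move=> restr_inj s [a aU sE] x.
pose id_aut := aut_of_morphism (f := [the {lrmorphism L -> L} of idfun])
  (@inj_id L) (fun y => erefl (e y)).
suff -> : s = id_aut by rewrite aut_of_morphismE.
apply: restr_inj; apply: aut_ext => z; apply: val_inj.
rewrite [LHS]aut_restrE [RHS]aut_restrE aut_of_morphismE sE.
by rewrite -center_centralP mulrK.
Qed.

End Converse.

Theorem theorem3p3 (K L : falgType rat) (e : {lrmorphism K -> L})
    (simpleK : simple_alg K) (simpleL : simple_alg L) (e_inj : injective e) :
  [<-> outer e;
       ('C(ext_img e) = 'Z({:L}))%VS;
       center_sub e /\ agenv (ext_img e + 'Z({:L})) = {:L}%VS;
       exists H : center_sub e, tensor_ext_iso H;
       exists H : center_sub e, bijective (aut_restr H)].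
Proof.
have [v uv] := dual_bases_exist simpleK.
tfae.
- exact: outer_cent.
- move=> CZ; exact: (cent_gen simpleK uv CZ).
- move=> [H gen]; exists H.
  exact: (outer_tensor_iso simpleK uv H (gen_cent gen)).
- move=> [H /tensor_iso_cent CZ]; exists H.
  exact: (outer_restr_bij simpleK uv H CZ simpleL).
- move=> [H /bij_inj]; exact: restr_inj_outer.
Qed.
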